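(* Let $k,m$ be integers with $0\le k\le m$ and $m\ge1$. We have $$L_{k,m}^Q=\left\{[z_0:f(z_0)x:c(z_0)y]\ :\ z_0\in\mathbb{C},\ |z_0|^2=\frac{1}{k+m+1}\left(2-\frac{1}{k+m+1}\right),\ x\in S^k,\ y\in S^m\right\}.$$
   Context: $\mathbb{C}P^N(\sqrt2)$ is $\mathbb{C}P^N$ with homogeneous coordinates normalized by $\sum|z_j|^2=2$; $Q_N(\sqrt2)=\{\sum z_j^2=0\}\subset\mathbb{C}P^N(\sqrt2)$. $S^k\subset\mathbb{R}^{k+1}$ and $S^m\subset\mathbb{R}^{m+1}$ are unit spheres, $S^0=\{\pm1\}$. With $D(1)$ the open unit disk in $\mathbb{C}$, the functions $f\colon D(1)\to\{z\in\mathbb{C}:|z|\le1,\mathrm{Im}(z)\ge0\}$ and $c\colon D(1)\to(0,\infty)$ are $$f(a+ib)=-\frac{ab}{\sqrt{1-b^2}}+i\sqrt{1-b^2},\qquad c(z)=\sqrt{2-|z|^2-|f(z)|^2}.$$ $L_{k,m}^Q=\Psi\left(\mathcal{P}_{k,m}^{1-\frac1{k+m+1}}\right)\subset Q_{k+m+2}(\sqrt2)$, where, with $T^*S^{n}=\{(p,q)\in\mathbb{R}^{n+1}\times\mathbb{R}^{n+1}:p\cdot q=0,|q|=1\}$ and $D_1^*S^n=\{|p|<1\}$, the map $\Psi\colon D_1^*S^{k+m+1}\to Q_{k+m+2}(\sqrt2)$ is $\Psi(p,q)=[\sqrt{1-|p|^2}:p+iq]$, and for $r>0$, $\mathcal{P}_{k,m}^r\subset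 T^*S^{k+m+1}$ is the image of $S^1\times S^k\times S^m\ni(e^{i\theta},x,y)\mapsto\big((-r\sin\theta\,x,r\cos\theta\,y),(\cos\theta\,x,\sin\theta\,y)\big)$. *)

(* Defs.v *)
From HB Require Import structures.
From mathcomp Require Import all_boot all_order all_algebra.
From mathcomp Require Import generic_quotient.
From mathcomp Require Import boolp classical_sets reals trigo.
From mathcomp.real_closed Require Import complex.
From mathcomp Require Import ring lra.


Set Implicit Arguments.
Unset Strict Implicit.
Unset Printing Implicit Defensive.

Import Order.TTheory GRing.Theory Num.Theory.
Import ComplexField.Normc.
Local Open Scope classical_set_scope.
Local Open Scope ring_scope.
Local Open Scope complex_scope.
Local Open Scope quotient_scope.

Section Euclidean.
Context {R : realType}.

Definition dot n (p q : 'rV[R]_n) : R := \sum_j p 0 j * q 0 j.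

Definition enorm n (p : 'rV[R]_n) : R := Num.sqrt (dot p p).

Definition Sphere n : set 'rV[R]_n.+1 := [set x | enorm x = 1].

(** Complexification of a real vector. *)
Definition toC n (x : 'rV[R]_n) : 'rV[R[i]]_n := map_mx (real_complex R) x.

Definition hnorm2 n (z : 'rV[R[i]]_n) : R := \sum_j normc (z 0 j) ^+ 2.

Lemma dot_ge0 n (p : 'rV[R]_n) : 0 <= dot p p.
Proof. by apply: sumr_ge0 => j _; rewrite -expr2 sqr_ge0. Qed.

Lemma enorm2 n (p : 'rV[R]_n) : enorm p ^+ 2 = dot p p.
Proof. by rewrite sqr_sqrtr ?dot_ge0. Qed.

Lemma normc2 (z : R[i]) : normc z ^+ 2 = complex.Re z ^+ 2 + complex.Im z ^+ 2.
Proof. by case: z => a b /=; rewrite sqr_sqrtr // addr_ge0 ?sqr_ge0. Qed.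

Lemma dot_row_mx n1 n2 (p q : 'rV[R]_n1) (p' q' : 'rV[R]_n2) :
  dot (row_mx p p') (row_mx q q') = dot p q + dot p' q'.
Proof.
rewrite /dot big_split_ord /=; congr (_ + _).
  by apply: eq_bigr => j _; rewrite !row_mxEl.
by apply: eq_bigr => j _; rewrite !row_mxEr.
Qed.

Lemma dotZZ n a b (p q : 'rV[R]_n) : dot (a *: p) (b *: q) = a * b * dot p q.
Proof.
by rewrite /dot mulr_sumr; apply: eq_bigr => j _; rewrite !mxE mulrACA.
Qed.

Lemma dot_Sphere n (x : 'rV[R]_n.+1) : Sphere x -> dot x x = 1.
Proof. by rewrite -enorm2 => ->; rewrite expr1n. Qed.

Lemma Sphere0P (x : 'rV[R]_1) : @Sphere 0 x <-> x = 1 \/ x = -1.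
Proof.
rewrite /Sphere /= /enorm /dot big_ord1 -expr2 sqrtr_sqr; split.
  move=> h; have: `|x 0 0| == 1 by rewrite h.
  rewrite eqr_norml ler01 andbT => /orP[] /eqP e; [left|right];
    by apply/rowP => j; rewrite ord1 e ?mxE.
by case=> ->; rewrite !mxE ?normrN /= normr1.
Qed.

Lemma hnorm2_row_mx n1 n2 (z : 'rV[R[i]]_n1) (w : 'rV[R[i]]_n2) :
  hnorm2 (row_mx z w) = hnorm2 z + hnorm2 w.
Proof.
rewrite /hnorm2 big_split_ord /=; congr (_ + _).
  by apply: eq_bigr => j _; rewrite row_mxEl.
by apply: eq_bigr => j _; rewrite row_mxEr.
Qed.

Lemma sum_sqr_row_mx n1 n2 (z : 'rV[R[i]]_n1) (w : 'rV[R[i]]_n2) :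
  \sum_j row_mx z w 0 j ^+ 2 = \sum_j z 0 j ^+ 2 + \sum_j w 0 j ^+ 2.
Proof.
rewrite big_split_ord /=; congr (_ + _).
  by apply: eq_bigr => j _; rewrite row_mxEl.
by apply: eq_bigr => j _; rewrite row_mxEr.
Qed.

Lemma hnorm2_scalar (a : R[i]) : hnorm2 (a%:M : 'rV_1) = normc a ^+ 2.
Proof. by rewrite /hnorm2 big_ord1 mxE. Qed.

Lemma hnorm2Z n (a : R[i]) (z : 'rV[R[i]]_n) :
  hnorm2 (a *: z) = normc a ^+ 2 * hnorm2 z.
Proof.
by rewrite /hnorm2 mulr_sumr; apply: eq_bigr => j _; rewrite mxE normcM exprMn.
Qed.

Lemma hnorm2_toC n (x : 'rV[R]_n) : hnorm2 (toC x) = dot x x.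
Proof.
by apply: eq_bigr => j _; rewrite mxE normc2 /= expr0n addr0 expr2.
Qed.

End Euclidean.

Arguments Sphere : clear implicits.

Section ProjectiveSpace.
Variables (R : realType) (N : nat).

(** CP^N(sqrt 2) is the quotient of the sphere of radius sqrt 2 in C^{N+1} by
    multiplication by unit complex numbers. *)
Definition hsphere := {z : 'rV[R[i]]_N.+1 | hnorm2 z == 2}.

Definition phase_eq (z w : hsphere) : bool :=
  `[< exists u : R[i], `|u| = 1 /\ val w = u *: val z >].

Lemma phase_refl : reflexive phase_eq.
Proof. by move=> z; apply/asboolP; exists 1; rewrite normr1 scale1r. Qed.

Lemma phase_sym : symmetric phase_eq.
Proof.
suff H z w : phase_eq z w -> phase_eq w z by move=> z w; apply/idP/idP; apply: H.
move=> /asboolP[u [u1 e]]; apply/asboolP; exists u^-1.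
have u0 : u != 0 by rewrite -normr_eq0 u1 oner_neq0.
by rewrite normfV u1 invr1 e scalerA mulVf // scale1r.
Qed.

Lemma phase_trans : transitive phase_eq.
Proof.
move=> w z t /asboolP[u [u1 e]] /asboolP[v [v1 e']]; apply/asboolP.
by exists (v * u); rewrite normrM u1 v1 mulr1 e' e scalerA.
Qed.

Canonical phase_equiv := EquivRel phase_eq phase_refl phase_sym phase_trans.

Definition CP := {eq_quot phase_equiv}.

Definition hbase_vec : 'rV[R[i]]_N.+1 :=
  (Num.sqrt 2)%:C *: delta_mx 0 0.

Lemma hbase_subproof : hnorm2 hbase_vec == 2.
Proof.
rewrite hnorm2Z normc2 /= expr0n addr0 sqr_sqrtr // /hnorm2.
rewrite (bigD1 ord0) //= big1 => [|j j0]; rewrite !mxE eqxx.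
  by rewrite normc1 expr1n addr0 mulr1.
by rewrite (negPf j0) normc0 expr0n.
Qed.

Definition hbase : hsphere := Sub hbase_vec hbase_subproof.

(** [hpt z] is the point [z_0 : ... : z_N] of CP^N(sqrt 2). The coordinates must
    be normalized; on vectors with [hnorm2 z != 2] the value is arbitrary. *)
Definition hpt (z : 'rV[R[i]]_N.+1) : CP := \pi_CP (insubd hbase z).

Lemma hptK (z : 'rV[R[i]]_N.+1) : hnorm2 z = 2 -> val (insubd hbase z) = z.
Proof. by move=> z2; rewrite val_insubd z2 eqxx. Qed.

Lemma hpt_eq (z w : 'rV[R[i]]_N.+1) : hnorm2 z = 2 -> hnorm2 w = 2 ->
  hpt z = hpt w <-> exists u : R[i], `|u| = 1 /\ w = u *: z.
Proof.
move=> z2 w2; rewrite /hpt; split.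
  by move=> /eqquotP/asboolP; rewrite !hptK.
by move=> h; apply/eqquotP/asboolP; rewrite !hptK.
Qed.

Lemma hpt_surj (P : CP) : exists2 z, hnorm2 z = 2 & P = hpt z.
Proof.
exists (val (repr P)); first exact/eqP/(valP (repr P)).
by rewrite /hpt valKd reprK.
Qed.

Definition Quadric : set CP :=
  [set P | exists z, [/\ hnorm2 z = 2, P = hpt z & \sum_j z 0 j ^+ 2 = 0]].

End ProjectiveSpace.

Arguments hpt {R N}.

Section Cotangent.
Variable R : realType.

(** T^*S^n, as pairs (p, q). *)
Definition TS n : set ('rV[R]_n.+1 * 'rV[R]_n.+1) :=
  [set w | dot w.1 w.2 = 0 /\ enorm w.2 = 1].

Definition D1TS n : set ('rV[R]_n.+1 * 'rV[R]_n.+1) :=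
  [set w | TS w /\ enorm w.1 < 1].

(** Homogeneous coordinates of [Psi (p, q)]. *)
Definition Psi_vec n (w : 'rV[R]_n.+1 * 'rV[R]_n.+1) : 'rV[R[i]]_(1 + n.+1) :=
  row_mx (Num.sqrt (1 - enorm w.1 ^+ 2))%:C%:M (toC w.1 + 'i *: toC w.2).

(** Psi : D_1^*S^n -> Q_{n+1}(sqrt 2), meaningful only on [D1TS n]. *)
Definition Psi n (w : 'rV[R]_n.+1 * 'rV[R]_n.+1) : CP R n.+1 :=
  hpt (Psi_vec w).

Lemma Psi_vec_norm n (w : 'rV[R]_n.+1 * 'rV[R]_n.+1) :
  D1TS w -> hnorm2 (Psi_vec w) = 2.
Proof.
case: w => p q [[/= pq q1] p1].
rewrite hnorm2_row_mx hnorm2_scalar normc2 /= expr0n addr0 sqr_sqrtr; last first.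
  by rewrite subr_ge0 expr_le1 // ?sqrtr_ge0 // ltW.
have -> : hnorm2 (toC p + 'i *: toC q) = dot p p + dot q q.
  rewrite /hnorm2 /dot -big_split; apply: eq_bigr => j _.
  rewrite !mxE normc2 /=.
  by rewrite mul0r !mul1r mulr0 !(addr0, add0r, subr0, oppr0, mulr0) -!expr2.
by rewrite -!enorm2 q1 expr1n addrA subrK.
Qed.

Lemma Psi_Quadric n (w : 'rV[R]_n.+1 * 'rV[R]_n.+1) :
  D1TS w -> Quadric (Psi w).
Proof.
move=> Dw; exists (Psi_vec w); split; [exact: Psi_vec_norm|by []|].
case: w Dw => p q [[/= pq q1] p1].
rewrite [LHS](@sum_sqr_row_mx R 1 n.+1) big_ord1 mxE /= mulr1n.
have -> : \sum_j (toC p + 'i *: toC q) 0 j ^+ 2 =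
    (dot p p - dot q q)%:C + (2 * dot p q) *i.
  transitivity (\sum_(j < n.+1) ((p 0 j * p 0 j - q 0 j * q 0 j)
      +i* (2 * (p 0 j * q 0 j)))).
    apply: eq_bigr => j _; rewrite !mxE expr2.
    apply/eqP; rewrite eq_complex /=; apply/andP; split; apply/eqP.
      by rewrite !(mul0r, mul1r, add0r, addr0, subr0, sub0r, oppr0, mulr0).
    rewrite !(mul0r, mul1r, add0r, addr0, subr0, sub0r, oppr0, mulr0).
    by rewrite [q 0 j * _]mulrC mulr_natl mulr2n.
  have H (F G : 'I_n.+1 -> R) : \sum_j (F j +i* G j) = (\sum_j F j) +i* (\sum_j G j).
    by elim/big_ind3: _ => // [x y z a b c -> ->] //.
  rewrite H sumrB -mulr_sumr; apply/eqP; rewrite eq_complex /=.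
  by rewrite addr0 add0r !eqxx.
rewrite -rmorphXn /= sqr_sqrtr; last first.
  by rewrite subr_ge0 expr_le1 // ?sqrtr_ge0 // ltW.
rewrite pq -!enorm2 q1 expr1n; apply/eqP; rewrite eq_complex /=.
by rewrite mulr0 !addr0 addrA subrK subrr !eqxx.
Qed.

(** P_{k,m}^r in T^*S^{k+m+1}, with S^1 parametrized by theta; here
    R^{k+m+2} is written R^{k+1} x R^{m+1}. *)
Definition Pkm (k m : nat) (r : R) :
    set ('rV[R]_(k + m.+1).+1 * 'rV[R]_(k + m.+1).+1) :=
  [set w | exists theta x y, [/\ Sphere R k x, Sphere R m y &
    w = (row_mx (- r * sin theta *: x) (r * cos theta *: y),
         row_mx (cos theta *: x) (sin theta *: y))]].

Lemma Pkm_TS k m r : @Pkm k m r `<=` @TS (k + m.+1).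
Proof.
move=> _ [t [x [y [/dot_Sphere x1 /dot_Sphere y1 ->]]]]; split => /=.
  rewrite [LHS](@dot_row_mx R k.+1 m.+1) !dotZZ x1 y1 !mulr1.
  by rewrite !mulNr addrC -mulrA -mulrA [sin t * _]mulrC subrr.
rewrite /enorm [dot _ _](@dot_row_mx R k.+1 m.+1) !dotZZ x1 y1 !mulr1.
by rewrite -!expr2 cos2Dsin2 sqrtr1.
Qed.

Lemma Pkm_D1TS k m r : 0 <= r -> r < 1 -> @Pkm k m r `<=` @D1TS (k + m.+1).
Proof.
move=> r0 r1 w Pw; split; first exact: Pkm_TS Pw.
case: Pw => [t [x [y [/dot_Sphere x1 /dot_Sphere y1 ->]]]] /=.
rewrite /enorm [dot _ _](@dot_row_mx R k.+1 m.+1) !dotZZ x1 y1 !mulr1.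
by rewrite -!expr2 mulNr sqrrN !exprMn -mulrDr addrC cos2Dsin2 mulr1 sqrtr_sqr
  ger0_norm.
Qed.

(** L_{k,m}^Q; the index [(k + m.+1).+1] is k+m+2. *)
Definition LQ (k m : nat) : set (CP R (k + m.+1).+1) :=
  @Psi (k + m.+1) @` @Pkm k m (1 - (k + m + 1)%:R^-1).

Lemma LQ_Quadric k m : @LQ k m `<=` @Quadric R (k + m.+1).+1.
Proof.
move=> _ [w Pw <-]; apply: (@Psi_Quadric (k + m.+1)).
apply: Pkm_D1TS Pw.
  by rewrite subr_ge0 invf_le1 ?ltr0n ?addn1 // ler1n.
by rewrite ltrBlDr ltrDl invr_gt0 ltr0n addn1.
Qed.

End Cotangent.

Arguments LQ : clear implicits.

Section Functions.
Context {R : realType}.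

(** Meaningful for |z| < 1 only, as is [c_disk]. *)
Definition f_disk (z : R[i]) : R[i] :=
  let: a +i* b := z in
  (- (a * b / Num.sqrt (1 - b ^+ 2))) +i* Num.sqrt (1 - b ^+ 2).

Definition c_disk (z : R[i]) : R :=
  Num.sqrt (2 - normc z ^+ 2 - normc (f_disk z) ^+ 2).

Lemma disk_Im (z : R[i]) : normc z < 1 -> 0 < 1 - complex.Im z ^+ 2.
Proof.
move=> z1; rewrite subr_gt0; apply: (@le_lt_trans _ _ (normc z ^+ 2)).
  by rewrite normc2 lerDr sqr_ge0.
by rewrite expr_lt1 //; case: (z) => a b /=; rewrite sqrtr_ge0.
Qed.

Lemma normc2_f_disk (z : R[i]) : normc z < 1 ->
  normc (f_disk z) ^+ 2 = 1 - normc z ^+ 2 + complex.Re z ^+ 2 / (1 - complex.Im z ^+ 2).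
Proof.
move=> /disk_Im; rewrite !normc2; case: z => a b /= h.
rewrite sqrrN exprMn exprVn sqr_sqrtr ?ltW // exprMn.
have h0 : 1 - b ^+ 2 != 0 by rewrite gt_eqF.
by field.
Qed.

Lemma disk_lt (z : R[i]) : normc z < 1 -> complex.Re z ^+ 2 / (1 - complex.Im z ^+ 2) < 1.
Proof.
move=> z1; rewrite ltr_pdivrMr ?disk_Im // mul1r ltrBrDr -normc2 expr_lt1 //.
by case: (z) => a b /=; rewrite sqrtr_ge0.
Qed.

Lemma disk_pos (z : R[i]) :
  normc z < 1 -> 0 < 2 - normc z ^+ 2 - normc (f_disk z) ^+ 2.
Proof.
move=> z1; rewrite normc2_f_disk // opprD opprB.
have -> (u t : R) : 2 - u + (u - 1 - t) = 1 - t.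
  by rewrite !addrA subrK -natr1 addrK.
by rewrite subr_gt0 disk_lt.
Qed.

Lemma c_disk_gt0 (z : R[i]) : normc z < 1 -> 0 < c_disk z.
Proof. by move=> z1; rewrite sqrtr_gt0 disk_pos. Qed.

Lemma Im_f_disk_ge0 (z : R[i]) : 0 <= complex.Im (f_disk z).
Proof. by case: z => a b; rewrite sqrtr_ge0. Qed.

Lemma normc_f_disk_le1 (z : R[i]) : normc z < 1 -> normc (f_disk z) <= 1.
Proof.
move=> z1; rewrite -(@expr_le1 _ 2) //; last first.
  by case: (f_disk z) => a b /=; rewrite sqrtr_ge0.
rewrite normc2_f_disk // normc2 -addrA gerDl addrC subr_le0.
rewrite ler_pdivrMr ?disk_Im //.
have : complex.Re z ^+ 2 + complex.Im z ^+ 2 < 1.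
  by rewrite -normc2 expr_lt1 //; case: (z) => x y /=; rewrite sqrtr_ge0.
move: (sqr_ge0 (complex.Im z)) (sqr_ge0 (complex.Re z)).
set a := complex.Re z ^+ 2; set b := complex.Im z ^+ 2; nra.
Qed.

Lemma fc_norm k m (z0 : R[i]) (x : 'rV[R]_k.+1) (y : 'rV[R]_m.+1) :
  normc z0 < 1 -> Sphere R k x -> Sphere R m y ->
  hnorm2 (row_mx (z0%:M : 'rV_1)
    (row_mx (f_disk z0 *: toC x) ((c_disk z0)%:C *: toC y))) = 2.
Proof.
move=> z1 /dot_Sphere x1 /dot_Sphere y1.
rewrite !hnorm2_row_mx hnorm2_scalar !hnorm2Z !hnorm2_toC x1 y1 !mulr1.
rewrite (normc2 (c_disk z0)%:C) /= expr0n addr0 sqr_sqrtr; last exact/ltW/disk_pos.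
by ring.
Qed.

Lemma circle_disk (k m : nat) (z0 : R[i]) : (1 <= m)%N ->
  normc z0 ^+ 2 = (k + m + 1)%:R^-1 * (2 - (k + m + 1)%:R^-1) -> normc z0 < 1.
Proof.
move=> m1 e; rewrite -(@expr_lt1 _ 2) //; last first.
  by case: (z0) => a b /=; rewrite sqrtr_ge0.
have : (k + m + 1)%:R^-1 < 1 :> R by rewrite invf_lt1 ?ltr0n ?ltr1n addn1 ?ltnS ?addn_gt0 ?m1 ?orbT.
rewrite e; set t := _^-1; nra.
Qed.

End Functions.

(* Main.v *)
(** Multiplying the homogeneous coordinates of
    [Psi (p, q) = [s : (-r sin + i cos) x : (r cos + i sin) y]], where
    [s = sqrt (1 - r^2)], by the phase [(r cos - i sin) / rho], where
    [rho = |r cos + i sin|], makes the coefficient of [y] equal to the positive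
    real [rho]. The new first coordinate [z0] has [|z0| = s], its imaginary part
    [b] satisfies [sqrt (1 - b^2) = r / rho], and hence the other two
    coefficients are [f z0] and [c z0]. Conversely [z0 = a + i b] comes from
    [cos = a / (s sqrt (1 - b^2))] and [sin = - r b / (s sqrt (1 - b^2))]. *)

Require Import Defs.
From mathcomp Require Import all_boot all_order all_algebra.
From mathcomp Require Import boolp classical_sets reals trigo.
From mathcomp.real_closed Require Import complex.
From mathcomp Require Import ring lra.


Import Order.TTheory GRing.Theory Num.Theory.
Import ComplexField.Normc.
Local Open Scope classical_set_scope.
Local Open Scope ring_scope.
Local Open Scope complex_scope.

Lemma unit_circle_angle {R : realType} (a b : R) :
  a ^+ 2 + b ^+ 2 = 1 -> exists t, a = cos t /\ b = sin t.
Proof.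
move=> ab1; have a1 : -1 <= a <= 1.
  by rewrite -ler_norml -(@expr_le1 _ 2) // real_normK ?num_real // -ab1 lerDl sqr_ge0.
have sb : sin (acos a) = `|b|.
  by rewrite sin_acos // -sqrtr_sqr; congr Num.sqrt; lra.
(* [acos] lands where the sine is nonnegative, so a negative [b] requires the opposite angle. *)
have [b0|b0] := leP 0 b.
  by exists (acos a); rewrite acosK ?sb ?ger0_norm ?in_itv.
by exists (- acos a); rewrite cosN sinN acosK ?sb ?ltr0_norm ?opprK ?in_itv.
Qed.

Lemma toC_row_mx_addi {R : realType} n1 n2
    (p q : 'rV[R]_n1) (p' q' : 'rV[R]_n2) :
  toC (row_mx p p') + 'i *: toC (row_mx q q') =
  row_mx (toC p + 'i *: toC q) (toC p' + 'i *: toC q').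
Proof. by rewrite /toC !map_row_mx scale_row_mx add_row_mx. Qed.

Lemma toC_scale_addi {R : realType} n (a b : R) (x : 'rV[R]_n) :
  toC (a *: x) + 'i *: toC (b *: x) = (a +i* b) *: toC x.
Proof.
rewrite /toC !map_mxZ scalerA -scalerDl; congr (_ *: _).
by rewrite [RHS]complexE.
Qed.

Section Normalization.
Context {R : realType} (r : R).
Hypotheses (r0 : 0 < r) (r1 : r < 1).

Let s : R := Num.sqrt (1 - r ^+ 2).

(** The arguments [C] and [S] stand for [cos] and [sin] of an angle. *)
Definition ellipse_norm (C S : R) : R := Num.sqrt ((r * C) ^+ 2 + S ^+ 2).

Definition ellipse_phase (C S : R) : R[i] :=
  (r * C / ellipse_norm C S) +i* (- (S / ellipse_norm C S)).

Let sqr_s : s ^+ 2 = 1 - r ^+ 2.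
Proof. by rewrite sqr_sqrtr // subr_ge0 expr_le1 // ltW. Qed.

Let s_gt0 : 0 < s.
Proof. by rewrite sqrtr_gt0 subr_gt0 expr_lt1 // ltW. Qed.

Lemma sqr_ellipse_norm C S : ellipse_norm C S ^+ 2 = (r * C) ^+ 2 + S ^+ 2.
Proof. by rewrite sqr_sqrtr // addr_ge0 ?sqr_ge0. Qed.

(** Since [r < 1], [(r C)^2 + S^2 >= r^2 (C^2 + S^2) = r^2 > 0]. *)
Lemma ellipse_norm_gt0 C S : C ^+ 2 + S ^+ 2 = 1 -> 0 < ellipse_norm C S.
Proof.
move=> CS; rewrite sqrtr_gt0 exprMn.
have := sqr_ge0 C; have := sqr_ge0 S.
have : 0 < r ^+ 2 by rewrite exprn_gt0.
have : r ^+ 2 < 1 by rewrite expr_lt1 // ltW.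
move: CS; set c2 := C ^+ 2; set s2 := S ^+ 2; set r2 := r ^+ 2; nra.
Qed.

Lemma normc_ellipse_phase C S :
  C ^+ 2 + S ^+ 2 = 1 -> normc (ellipse_phase C S) = 1.
Proof.
move=> /ellipse_norm_gt0/lt0r_neq0 n0.
rewrite /= -[RHS]sqrtr1; congr Num.sqrt.
by rewrite sqrrN !expr_div_n -mulrDl sqr_ellipse_norm divff // -sqr_ellipse_norm sqrf_eq0.
Qed.

(** With [rho = ellipse_norm C S], the imaginary part is [- s S / rho], and
    [rho^2 - s^2 S^2 = r^2 (C^2 + S^2) = r^2]. *)
Lemma sqrt_Im_ellipse C S : C ^+ 2 + S ^+ 2 = 1 ->
  Num.sqrt (1 - (complex.Im (s%:C * ellipse_phase C S)) ^+ 2)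
  = r / ellipse_norm C S.
Proof.
move=> CS; have n0 := ellipse_norm_gt0 _ _ CS.
rewrite -[RHS]ger0_norm ?divr_ge0 ?(ltW r0) ?(ltW n0) // -sqrtr_sqr.
congr Num.sqrt; rewrite /= mul0r addr0 mulrN sqrrN.
have n2 := sqr_ellipse_norm C S.
have {}n0 := lt0r_neq0 n0.
apply: (mulIf (expf_neq0 2 n0)); transitivity (r ^+ 2); last by field.
transitivity (ellipse_norm C S ^+ 2 - s ^+ 2 * S ^+ 2); first by field.
have -> : S ^+ 2 = 1 - C ^+ 2 by lra.
(* Rewriting with [n2] brings back an [S ^+ 2], hence the second substitution. *)
rewrite n2 sqr_s; have -> : S ^+ 2 = 1 - C ^+ 2 by lra.
by ring.
Qed.

(** Both sides equal [(s^2 C S + i r) / rho]. *)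
Lemma f_disk_ellipse C S : C ^+ 2 + S ^+ 2 = 1 ->
  f_disk (s%:C * ellipse_phase C S) = ellipse_phase C S * ((- r * S) +i* C).
Proof.
move=> CS; have n0 := lt0r_neq0 (ellipse_norm_gt0 _ _ CS).
have := sqrt_Im_ellipse _ _ CS; have r_neq0 := lt0r_neq0 r0.
case e: (s%:C * _) => [a b] /= ->; move: e => [<- <-].
apply/eqP; rewrite eq_complex /=; apply/andP; split; apply/eqP.
  transitivity (s ^+ 2 * C * S / ellipse_norm C S); first by field; apply/andP.
  by rewrite sqr_s; field.
transitivity (r * (C ^+ 2 + S ^+ 2) / ellipse_norm C S); last by field.
by rewrite CS mulr1.
Qed.

Lemma normc2_ellipse C S : C ^+ 2 + S ^+ 2 = 1 ->
  normc (s%:C * ellipse_phase C S) ^+ 2 = 1 - r ^+ 2.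
Proof.
move=> CS; rewrite normcM normc_ellipse_phase // mulr1 normc2 /= sqr_s.
by rewrite expr0n addr0.
Qed.

(** The unit phase drops out of both moduli, leaving [2 - (1 - r^2) - (r^2 S^2 + C^2) = r^2 C^2 +
    S^2]. *)
Lemma c_disk_ellipse C S : C ^+ 2 + S ^+ 2 = 1 ->
  c_disk (s%:C * ellipse_phase C S) = ellipse_norm C S.
Proof.
move=> CS; rewrite /c_disk normc2_ellipse // f_disk_ellipse // normcM.
rewrite normc_ellipse_phase // mul1r normc2 /= /ellipse_norm; congr Num.sqrt.
have -> : C ^+ 2 = 1 - S ^+ 2 by lra.
by rewrite !exprMn; have -> : C ^+ 2 = 1 - S ^+ 2 by [lra]; ring.
Qed.

(** The phase is the conjugate of [r C + i S] divided by its modulus. *)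
Lemma ellipse_phase_conj C S : C ^+ 2 + S ^+ 2 = 1 ->
  ellipse_phase C S * ((r * C) +i* S) = (ellipse_norm C S)%:C.
Proof.
move=> CS; have n0 := lt0r_neq0 (ellipse_norm_gt0 _ _ CS).
apply/eqP; rewrite eq_complex /=; apply/andP; split; apply/eqP; last by field.
apply: (mulIf n0); rewrite -expr2 sqr_ellipse_norm; by field.
Qed.

Lemma ellipse_phase_surj (z : R[i]) : normc z ^+ 2 = 1 - r ^+ 2 ->
  exists C S, C ^+ 2 + S ^+ 2 = 1 /\ z = s%:C * ellipse_phase C S.
Proof.
rewrite normc2; case: z => a b /= ab.
(* By [ab], [1 - b^2 = a^2 + r^2]. *)
have b1 : 0 < 1 - b ^+ 2.
  have := sqr_ge0 a; have : 0 < r ^+ 2 by rewrite exprn_gt0.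
  lra.
set w := Num.sqrt (1 - b ^+ 2).
have w2 : w ^+ 2 = 1 - b ^+ 2 by rewrite sqr_sqrtr // ltW.
have w0 : 0 < w by rewrite sqrtr_gt0.
have sN0 := lt0r_neq0 s_gt0; have wN0 := lt0r_neq0 w0; have rN0 := lt0r_neq0 r0.
exists (a / (s * w)), (- (r * b / (s * w))).
have ne : ellipse_norm (a / (s * w)) (- (r * b / (s * w))) = r / w.
  rewrite -[RHS]ger0_norm ?divr_ge0 ?(ltW r0) ?(ltW w0) // -sqrtr_sqr.
  congr Num.sqrt; transitivity (r ^+ 2 * (a ^+ 2 + b ^+ 2) / (s ^+ 2 * w ^+ 2)).
    by field; apply/andP.
  by rewrite ab -sqr_s; field; apply/andP.
split.
  (* The numerator [a^2 + r^2 b^2] is arranged so that [ab] turns it into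
     [s^2 - s^2 b^2 = s^2 w^2]. *)
  transitivity ((a ^+ 2 + b ^+ 2 - (1 - r ^+ 2) * b ^+ 2) / (s ^+ 2 * w ^+ 2)).
    by field; apply/andP.
  rewrite ab -sqr_s (_ : _ - _ = s ^+ 2 * w ^+ 2); last by rewrite w2; ring.
  by rewrite divff // mulf_neq0 ?expf_neq0.
rewrite /ellipse_phase ne; apply/eqP; rewrite eq_complex /=.
by apply/andP; split; apply/eqP; field; rewrite ?rN0 ?sN0 ?wN0.
Qed.

(** Both inclusions of the theorem rest on this: the two coordinate vectors differ by the factor
    [ellipse_phase C S]. *)
Lemma Psi_ellipse k m (C S : R) (x : 'rV[R]_k.+1) (y : 'rV[R]_m.+1) (z0 : R[i]) :
  C ^+ 2 + S ^+ 2 = 1 -> z0 = s%:C * ellipse_phase C S -> Sphere R k x -> Sphere R m y ->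
  @Psi R (k + m.+1) (row_mx (- r * S *: x) (r * C *: y),
                     row_mx (C *: x) (S *: y)) =
  hpt (row_mx z0%:M (row_mx (f_disk z0 *: toC x) ((c_disk z0)%:C *: toC y))).
Proof.
move=> CS ez0 Sx Sy.
have [x1 y1] := (dot_Sphere Sx, dot_Sphere Sy).
have z01 : normc z0 < 1.
  rewrite -(@expr_lt1 _ 2) ?ez0 ?normc2_ellipse ?gtrBl ?exprn_gt0 //.
  by case: (_ * _) => ? ?; exact: sqrtr_ge0.
(* The angle places the pair in [Pkm], hence in [D1TS], which gives the normalization that [hpt_eq]
   requires. *)
have [t [eC eS]] := unit_circle_angle _ _ CS.
have D1 : @D1TS R (k + m.+1) (row_mx (- r * S *: x) (r * C *: y),
                     row_mx (C *: x) (S *: y)).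
  by apply: (@Pkm_D1TS _ k m r) => //; [exact: ltW|exists t, x, y; rewrite -eC -eS].
apply/hpt_eq; [exact: Psi_vec_norm D1|exact: fc_norm|].
exists (ellipse_phase C S); split.
  by rewrite -[LHS]/((normc (ellipse_phase C S))%:C) normc_ellipse_phase.
have p2 : enorm (row_mx (- r * S *: x) (r * C *: y)) ^+ 2 = r ^+ 2.
  rewrite enorm2 dot_row_mx !dotZZ x1 y1 !mulr1 -!expr2 !exprMn sqrrN -mulrDr.
  by rewrite addrC CS mulr1.
(* Reading [ellipse_phase_conj] backwards exposes the common phase in the coefficient of [y]. *)
rewrite ez0 f_disk_ellipse // c_disk_ellipse // -ellipse_phase_conj //.
rewrite /Psi_vec /fst /snd p2 [RHS](@scale_row_mx _ 1 1 (k.+1 + m.+1)).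
apply: (congr2 (@row_mx _ 1 1 (k.+1 + m.+1))).
  by rewrite scale_scalar_mx mulrC.
rewrite [X in _ = _ *: X](@toC_row_mx_addi R k.+1 m.+1).
by rewrite !toC_scale_addi [RHS](@scale_row_mx _ 1 k.+1 m.+1) !scalerA.
Qed.

End Normalization.

Theorem proposition6p4 (R : realType) (k m : nat)
    (hkm : (k <= m)%N) (hm : (1 <= m)%N) :
  LQ R k m =
  [set P : CP R (k + m.+1).+1 |
    exists (z0 : R[i]) (x : 'rV[R]_k.+1) (y : 'rV[R]_m.+1),
      [/\ normc z0 ^+ 2 = (k + m + 1)%:R^-1 * (2 - (k + m + 1)%:R^-1),
          Sphere R k x,
          Sphere R m y
        & P = hpt (row_mx z0%:M
                    (row_mx (f_disk z0 *: toC x) ((c_disk z0)%:C *: toC y)))]].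
Proof.
set t : R := (k + m + 1)%:R^-1.
have t0 : 0 < t by rewrite invr_gt0 ltr0n addn1.
(* As [m >= 1], the denominator [k + m + 1] is at least 2; this makes the radius [1 - t]
   positive. *)
have t1 : t < 1.
  by rewrite invf_lt1 ?ltr0n ?ltr1n addn1 ?ltnS ?addn_gt0 ?hm ?orbT.
have r0 : 0 < 1 - t by lra.
have r1 : 1 - t < 1 by lra.
(* The prescribed [|z0|^2] is [1 - r^2] for [r = 1 - t]. *)
have rt : t * (2 - t) = 1 - (1 - t) ^+ 2 by ring.
apply/seteqP; split=> [_ [_ [a [x [y [Sx Sy ->]]]] <-]|P].
  have CS := cos2Dsin2 a; rewrite (Psi_ellipse _ r0 r1 _ _ _ _ _ _ _ CS erefl) //.
  do 3 eexists; split; [|exact: Sx|exact: Sy|by []].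
  by rewrite rt normc2_ellipse.
move=> [z0 [x [y [+ Sx Sy ->]]]]; rewrite rt.
move=> /(ellipse_phase_surj _ r0 r1)[C [S [CS ->]]].
have [a [eC eS]] := unit_circle_angle _ _ CS.
rewrite -(Psi_ellipse _ r0 r1 _ _ _ _ _ _ _ CS erefl) // eC eS.
by eexists; [exists a, x, y|].
Qed.
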